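(* Let $r,n,s,f,A$ be integers with $n>0$, $r\geq 0$ and $f(r-s)\equiv 0\bmod n$. Let $E=\langle t,y\mid t^n,\ y^rt^Ay^{-s}t^{-A}\rangle$ and let $G$ be the kernel of the retraction $\nu^f:E\to\langle t\rangle$, $\nu^f(t)=t$, $\nu^f(y)=t^f$. Then $E$ (and hence $G$) is either large or virtually abelian.
   Context: The subgroup $\langle t\rangle\le E$ is cyclic of order $n$. A group is large if it has a finite index subgroup that surjects onto the free group of rank $2$. A group is virtually abelian if it has an abelian subgroup of finite index. *)

(* Defs.v *)
From HB Require Import structures.
From mathcomp Require Import all_boot all_order all_algebra.
From mathcomp Require Import boolp classical_sets functions cardinality.

Set Implicit Arguments.
Unset Strict Implicit.
Unset Printing Implicit Defensive.

Import GRing.Theory.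

Local Open Scope classical_set_scope.
Local Open Scope quotient_scope.
Local Open Scope group_scope.

Notation "{ 'hom' G -> H }" := (UMagmaMorphism.type G%type H%type)
  (at level 0, G at level 98, H at level 99) : type_scope.

Section IntegerPowers.
Variable G : groupType.
Implicit Types (x : G) (m k : int).

Definition zexpg x m : G :=
  match m with Posz k => x ^+ k | Negz k => x ^- k.+1 end.

Lemma zexpg1 x : zexpg x 1%R = x.
Proof. by []. Qed.

Lemma zexpgN x m : zexpg x (- m)%R = (zexpg x m)^-1.
Proof. by case: m => [[|k]|k] /=; rewrite ?invg1 ?invgK. Qed.

Lemma zexpgS x m : zexpg x (m + 1)%R = zexpg x m * x.
Proof.
case: m => [k|[|k]]; first by rewrite -PoszD addn1 /= expgSr.
- by rewrite /= expg1 mulVg.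
- have -> : (Negz k.+1 + 1)%R = Negz k.
    by rewrite !NegzE -addn1 PoszD opprD addrNK.
  by rewrite /= (expgS x k.+1) invgM mulgVK.
Qed.

Lemma zexpgB1 x m : zexpg x (m - 1)%R = zexpg x m * x^-1.
Proof. by apply: (canRL (mulgK x)); rewrite -zexpgS subrK. Qed.

Lemma zexpgD x m k : zexpg x (m + k)%R = zexpg x m * zexpg x k.
Proof.
elim: k => [|k IH|k IH]; first by rewrite addr0 mulg1.
- by rewrite -addn1 PoszD addrA !zexpgS IH mulgA.
- by rewrite -addn1 PoszD opprD addrA !zexpgB1 IH mulgA.
Qed.

Lemma zexpgM x m k : zexpg x (m * k)%R = zexpg (zexpg x m) k.
Proof.
elim: k => [|k IH|k IH]; first by rewrite mulr0.
- rewrite -addn1 PoszD mulrDr mulr1 zexpgS -IH.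
  exact: zexpgD.
- rewrite -addn1 PoszD opprD mulrDr mulrN1 zexpgB1 -IH -zexpgN.
  exact: zexpgD.
Qed.

End IntegerPowers.

Lemma hom_zexpg (G H : groupType) (phi : {hom G -> H}) x m :
  phi (zexpg x m) = zexpg (phi x) m.
Proof. by case: m => k /=; rewrite ?gmulfV gmulfXn. Qed.

Section Subgroups.
Variable G : groupType.

Definition subg_of (S : {pred G}) : Type := {x : G | x \in S}.

HB.instance Definition _ (S : {pred G}) := SubChoice.on (subg_of S).

Section SubgroupType.
Variable H : groupClosed G.
Fact subg_closed : group_closed (mem H).
Proof. by split=> [|x y]; [exact: gpred1 | exact: gpredF]. Qed.
HB.instance Definition _ :=
  SubChoice_isSubGroup.Build G _ (subg_of H) subg_closed.
End SubgroupType.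

Definition finite_index (H : {pred G}) : Prop :=
  finite_set (range (fun x : G => [set x * h | h in [set` H]])).

Definition cycleg (x : G) : {pred G} :=
  [pred z | `[< exists k : int, z = zexpg x k >]].

Lemma cyclegP (x z : G) : reflect (exists k, z = zexpg x k) (z \in cycleg x).
Proof. exact: asboolP. Qed.

Section CyclicSubgroup.
Variable x : G.
Fact cycleg_invg : invg_closed (cycleg x).
Proof.
by move=> _ /cyclegP[k ->]; apply/cyclegP; exists (- k)%R; rewrite zexpgN.
Qed.
Fact cycleg1 : 1 \in cycleg x.
Proof. by apply/cyclegP; exists 0%R. Qed.
Fact cycleg_mulg : mulg_closed (cycleg x).
Proof.
move=> _ _ /cyclegP[k ->] /cyclegP[l ->].
by apply/cyclegP; exists (k + l)%R; rewrite zexpgD.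
Qed.
(* The join instance GroupClosed is only found when declared in this order. *)
HB.instance Definition _ := isMulClosed.Build G (cycleg x) cycleg_mulg.
HB.instance Definition _ := isMul1Closed.Build G (cycleg x) cycleg1.
HB.instance Definition _ := isInvClosed.Build G (cycleg x) cycleg_invg.
End CyclicSubgroup.

Lemma cycleg_id (x : G) : x \in cycleg x.
Proof. by apply/cyclegP; exists 1%R. Qed.

Definition cycleg_gen (x : G) : subg_of (cycleg x) := exist _ x (cycleg_id x).

End Subgroups.

Section Kernel.
Variables (G H : groupType) (phi : {hom G -> H}).
Definition kerg : {pred G} := [pred x | phi x == 1].
Fact kerg_invg : invg_closed kerg.
Proof. by move=> x /eqP xK; rewrite inE gmulfV xK invg1. Qed.
Fact kerg1 : 1 \in kerg.
Proof. by rewrite inE gmulf1. Qed.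
Fact kerg_mulg : mulg_closed kerg.
Proof. by move=> x y /eqP xK /eqP yK; rewrite inE gmulfM xK yK mulg1. Qed.
HB.instance Definition _ := isMulClosed.Build G kerg kerg_mulg.
HB.instance Definition _ := isMul1Closed.Build G kerg kerg1.
HB.instance Definition _ := isInvClosed.Build G kerg kerg_invg.
End Kernel.

(* The free group on X: words in the letters x = (x, true) and
   x^-1 = (x, false), up to insertion and deletion of x x^-1 and x^-1 x. *)
Section FreeGroup.
Variable X : choiceType.
Notation word := (seq (X * bool)).
Implicit Types u v w : word.

Inductive free_eq : word -> word -> Prop :=
| free_eq_refl w : free_eq w w
| free_eq_sym u v : free_eq u v -> free_eq v u
| free_eq_trans u v w : free_eq u v -> free_eq v w -> free_eq u w
| free_eq_cancel u v x b :
    free_eq (u ++ [:: (x, b), (x, ~~ b) & v]) (u ++ v).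

Definition free_rel : rel word := fun u v => `[< free_eq u v >].

Fact free_rel_refl : reflexive free_rel.
Proof. by move=> u; apply/asboolP; exact: free_eq_refl. Qed.
Fact free_rel_sym : symmetric free_rel.
Proof. by move=> u v; apply/asboolP/asboolP; exact: free_eq_sym. Qed.
Fact free_rel_trans : transitive free_rel.
Proof.
by move=> v u w /asboolP uv /asboolP vw; apply/asboolP/(free_eq_trans uv vw).
Qed.

Canonical free_equiv :=
  EquivRel free_rel free_rel_refl free_rel_sym free_rel_trans.

Definition free_group : Type := {eq_quot free_equiv}.
HB.instance Definition _ := Choice.on free_group.
HB.instance Definition _ := EqQuotient.on free_group.

Lemma free_pi_eq u v : free_eq u v <-> \pi_free_group u = \pi_free_group v.
Proof.
split=> [uv|/eqmodP /asboolP //].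
by apply/eqmodP; apply/asboolP.
Qed.

Lemma free_eq_repr u : free_eq (repr (\pi_free_group u)) u.
Proof. by apply/free_pi_eq; rewrite reprK. Qed.

Definition word_inv w : word := rev [seq (l.1, ~~ l.2) | l <- w].

Definition free_mul (a b : free_group) : free_group :=
  \pi_free_group (repr a ++ repr b).
Definition free_one : free_group := \pi_free_group [::].
Definition free_inv (a : free_group) : free_group := 
  \pi_free_group (word_inv (repr a)).

Lemma free_eq_catl w u v : free_eq u v -> free_eq (w ++ u) (w ++ v).
Proof.
elim=> {u v}[u|u v _|u v t _ uv _|u v x b].
- exact: free_eq_refl.
- exact: free_eq_sym.
- exact: free_eq_trans uv.
- by rewrite !catA; exact: free_eq_cancel.
Qed.

Lemma free_eq_catr w u v : free_eq u v -> free_eq (u ++ w) (v ++ w).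
Proof.
elim=> {u v}[u|u v _|u v t _ uv _|u v x b].
- exact: free_eq_refl.
- exact: free_eq_sym.
- exact: free_eq_trans uv.
- by rewrite -!catA; exact: free_eq_cancel.
Qed.

Lemma free_eq_cat u u' v v' :
  free_eq u u' -> free_eq v v' -> free_eq (u ++ v) (u' ++ v').
Proof.
move=> uu' vv'.
exact: free_eq_trans (free_eq_catr v uu') (free_eq_catl u' vv').
Qed.

Lemma word_invK : involutive word_inv.
Proof.
move=> w; rewrite /word_inv map_rev revK -map_comp -[RHS]map_id.
by apply: eq_map => -[x b] /=; rewrite negbK.
Qed.

Lemma free_eq_invr w : free_eq (w ++ word_inv w) [::].
Proof.
elim: w => [|[x b] w IH]; first exact: free_eq_refl.
have -> : word_inv ((x, b) :: w) = word_inv w ++ [:: (x, ~~ b)].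
  by rewrite /word_inv /= rev_cons cats1.
apply: free_eq_trans (free_eq_cancel [::] [::] x b); rewrite catA.
exact: (free_eq_catl [:: (x, b)] (free_eq_catr [:: (x, ~~ b)] IH)).
Qed.

Lemma free_eq_invl w : free_eq (word_inv w ++ w) [::].
Proof. by rewrite -{2}[w]word_invK; exact: free_eq_invr. Qed.

Fact free_mulA : associative free_mul.
Proof.
move=> a b c; apply/free_pi_eq.
apply: free_eq_trans (free_eq_catl _ (free_eq_repr _)) _.
rewrite catA; apply: free_eq_sym; exact: free_eq_catr (free_eq_repr _).
Qed.
Fact free_mul1 : left_id free_one free_mul.
Proof.
move=> a; rewrite -[RHS]reprK; apply/free_pi_eq.
exact: free_eq_catr (free_eq_repr [::]).
Qed.
Fact free_mul1r : right_id free_one free_mul.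
Proof.
move=> a; rewrite -[RHS]reprK; apply/free_pi_eq.
rewrite -[X in free_eq _ X]cats0; exact: free_eq_catl (free_eq_repr [::]).
Qed.
Fact free_mulV : left_inverse free_one free_inv free_mul.
Proof.
move=> a; apply/free_pi_eq.
by apply: free_eq_trans (free_eq_catr _ (free_eq_repr _)) (free_eq_invl _).
Qed.
Fact free_mulVr : right_inverse free_one free_inv free_mul.
Proof.
move=> a; apply/free_pi_eq.
by apply: free_eq_trans (free_eq_catl _ (free_eq_repr _)) (free_eq_invr _).
Qed.

HB.instance Definition _ :=
  isGroup.Build free_group free_mulA free_mul1 free_mul1r free_mulV free_mulVr.

Definition free_gen (x : X) : free_group := \pi_free_group [:: (x, true)].

Section FreeLift.
Variables (G : groupType) (g : X -> G).

Definition word_eval w : G :=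
  \prod_(l <- w) (if l.2 then g l.1 else (g l.1)^-1).

Lemma word_eval_eq u v : free_eq u v -> word_eval u = word_eval v.
Proof.
elim=> {u v}// [u v w _ -> _ -> //|u v x b].
rewrite /word_eval !big_cat !big_cons /=; congr (_ * _).
by rewrite mulgA; case: b; rewrite /= ?mulgV ?mulVg mul1g.
Qed.

Definition free_lift (a : free_group) : G := word_eval (repr a).

Fact free_lift_morph : monoid.monoid_morphism free_lift.
Proof.
split=> [|a b].
  by rewrite /free_lift (word_eval_eq (free_eq_repr _)) /word_eval big_nil.
rewrite /free_lift (word_eval_eq (free_eq_repr _)).
by rewrite /word_eval big_cat.
Qed.
HB.instance Definition _ :=
  isUMagmaMorphism.Build free_group G free_lift free_lift_morph.

Lemma free_lift_gen x : free_lift (free_gen x) = g x.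
Proof.
by rewrite /free_lift (word_eval_eq (free_eq_repr _)) /word_eval big_seq1.
Qed.

End FreeLift.
End FreeGroup.

Section NormalClosure.
Variables (F : groupType) (R : set F).

Inductive normal_closure : set F :=
| ncl_rel x : R x -> normal_closure x
| ncl_one : normal_closure 1
| ncl_mul x y : normal_closure x -> normal_closure y -> normal_closure (x * y)
| ncl_inv x : normal_closure x -> normal_closure x^-1
| ncl_conj x y : normal_closure x -> normal_closure (x ^ y).

End NormalClosure.

(* < X | R >, the free group on X modulo the normal closure of R. *)
Section Presentation.
Variables (X : choiceType) (R : set (free_group X)).
Notation F := (free_group X).
Notation N := (normal_closure R).

Definition pres_rel : rel F := fun x y => `[< N (x^-1 * y) >].

Fact pres_rel_refl : reflexive pres_rel.
Proof. by move=> x; apply/asboolP; rewrite mulVg; exact: ncl_one. Qed.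
Fact pres_rel_sym : symmetric pres_rel.
Proof.
by move=> x y; apply/asboolP/asboolP => /ncl_inv; rewrite invgM invgK.
Qed.
Fact pres_rel_trans : transitive pres_rel.
Proof.
move=> y x z /asboolP xy /asboolP yz; apply/asboolP.
by have := ncl_mul xy yz; rewrite mulgA mulgK.
Qed.

Canonical pres_equiv :=
  EquivRel pres_rel pres_rel_refl pres_rel_sym pres_rel_trans.

Definition presented : Type := {eq_quot pres_equiv}.
HB.instance Definition _ := Choice.on presented.
HB.instance Definition _ := EqQuotient.on presented.

Lemma pres_pi_eq x y : N (x^-1 * y) <-> \pi_presented x = \pi_presented y.
Proof.
split=> [xy|/eqmodP /asboolP //].
by apply/eqmodP; apply/asboolP.
Qed.

Lemma pres_repr x : N ((repr (\pi_presented x))^-1 * x).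
Proof. by apply/pres_pi_eq; rewrite reprK. Qed.

Definition pres_mul (a b : presented) : presented := 
  \pi_presented (repr a * repr b).
Definition pres_one : presented := \pi_presented 1.
Definition pres_inv (a : presented) : presented := \pi_presented (repr a)^-1.

Lemma pres_mul_pi x y :
  pres_mul (\pi_presented x) (\pi_presented y) = \pi_presented (x * y).
Proof.
apply/pres_pi_eq; set x' := repr _; set y' := repr _.
have -> : (x' * y')^-1 * (x * y) = (x'^-1 * x) ^ y' * (y'^-1 * y).
  by rewrite /conjg invgM !mulgA mulgK.
by apply: ncl_mul; [apply: ncl_conj|]; exact: pres_repr.
Qed.

Lemma pres_inv_pi x : pres_inv (\pi_presented x) = \pi_presented x^-1.
Proof.
apply/pres_pi_eq; rewrite invgK; set x' := repr _.
have -> : x' * x^-1 = ((x'^-1 * x) ^ x^-1)^-1.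
  by rewrite /conjg !mulgA invgK !invgM !invgK mulgA mulgV mul1g.
by apply/ncl_inv/ncl_conj; exact: pres_repr.
Qed.

Fact pres_mulA : associative pres_mul.
Proof.
elim/quotW=> x; elim/quotW=> y; elim/quotW=> z.
by rewrite (pres_mul_pi y z) (pres_mul_pi x y) !pres_mul_pi mulgA.
Qed.
Fact pres_mul1 : left_id pres_one pres_mul.
Proof. by elim/quotW=> x; rewrite pres_mul_pi mul1g. Qed.
Fact pres_mul1r : right_id pres_one pres_mul.
Proof. by elim/quotW=> x; rewrite pres_mul_pi mulg1. Qed.
Fact pres_mulV : left_inverse pres_one pres_inv pres_mul.
Proof. by elim/quotW=> x; rewrite pres_inv_pi pres_mul_pi mulVg. Qed.
Fact pres_mulVr : right_inverse pres_one pres_inv pres_mul.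
Proof. by elim/quotW=> x; rewrite pres_inv_pi pres_mul_pi mulgV. Qed.

HB.instance Definition _ :=
  isGroup.Build presented pres_mulA pres_mul1 pres_mul1r pres_mulV pres_mulVr.

Definition pres_pi (x : F) : presented := \pi_presented x.
Fact pres_pi_morph : monoid.monoid_morphism pres_pi.
Proof. by split=> // x y; exact: esym (pres_mul_pi x y). Qed.
HB.instance Definition _ :=
  isUMagmaMorphism.Build F presented pres_pi pres_pi_morph.

Definition pres_gen (x : X) : presented := pres_pi (free_gen x).

Lemma pres_pi_rel x : R x -> pres_pi x = 1.
Proof.
move=> Rx; apply: esym; apply: (pres_pi_eq 1 x).1.
by rewrite invg1 mul1g; exact: ncl_rel.
Qed.

Section PresLift.
Variables (G : groupType) (g : X -> G).
Definition pres_lift (gR : forall x, R x -> free_lift g x = 1)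
    (a : presented) : G :=
  free_lift g (repr a).

Hypothesis gR : forall x, R x -> free_lift g x = 1.

Lemma free_lift_ncl x : N x -> free_lift g x = 1.
Proof.
elim=> {x}[x /gR //||x y _ xN _ yN|x _ xN|x y _ xN].
- by rewrite gmulf1.
- by rewrite gmulfM /= xN yN mulg1.
- by rewrite gmulfV /= xN invg1.
- by rewrite gmulfJ /= xN conj1g.
Qed.

Lemma pres_lift_pi x : pres_lift gR (pres_pi x) = free_lift g x.
Proof.
have /free_lift_ncl := pres_repr x; rewrite gmulfM gmulfV /= => xN.
by rewrite -[RHS](mulVKg (pres_lift gR (pres_pi x))) xN mulg1.
Qed.

Fact pres_lift_morph : monoid.monoid_morphism (pres_lift gR).
Proof.
split=> [|a b]; first exact: etrans (pres_lift_pi 1) gmulf1.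
elim/quotW: a => x; elim/quotW: b => y.
rewrite -/(pres_pi x) -/(pres_pi y) -gmulfM !pres_lift_pi.
exact: gmulfM.
Qed.
HB.instance Definition _ :=
  isUMagmaMorphism.Build presented G (pres_lift gR) pres_lift_morph.

Lemma pres_lift_gen x : pres_lift gR (pres_gen x) = g x.
Proof. by rewrite pres_lift_pi free_lift_gen. Qed.

End PresLift.
End Presentation.

Definition large (G : groupType) : Prop :=
  exists2 H : groupClosed G, finite_index H &
    exists phi : {hom subg_of H -> free_group 'I_2}, range phi = setT.

Definition virtually_abelian (G : groupType) : Prop :=
  exists2 H : groupClosed G, finite_index H & {in H &, commutative *%g}.

(* The generators t and y are the letters 0 and 1 of 'I_2. *)
Definition free_t : free_group 'I_2 := free_gen ord0.
Definition free_y : free_group 'I_2 := free_gen ord_max.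

Section TheGroup.
Variables r n s A : int.

Definition E_relators : set (free_group 'I_2) :=
  [set zexpg free_t n;
       zexpg free_y r * zexpg free_t A
         * zexpg free_y (- s)%R * zexpg free_t (- A)%R].

Definition E_group : groupType := presented E_relators.

Definition E_t : E_group := pres_gen E_relators ord0.
Definition E_y : E_group := pres_gen E_relators ord_max.

Lemma E_t_order : zexpg E_t n = 1.
Proof. by rewrite -hom_zexpg; apply: pres_pi_rel; left. Qed.

(* nu^f : E -> <t>, the homomorphism with t |-> t and y |-> t^f; see nu_t,
   nu_y and nu_retraction. *)
Section Retraction.
Variable f : int.
Hypothesis hf : (f * (r - s))%R = 0 %[mod n]%Z.

Definition nu_gen (i : 'I_2) : subg_of (cycleg E_t) :=
  if i == ord0 then cycleg_gen E_t else zexpg (cycleg_gen E_t) f.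

Fact nu_relators x : E_relators x -> free_lift nu_gen x = 1.
Proof.
have tn : zexpg (cycleg_gen E_t) n = 1.
  by apply: val_inj; rewrite hom_zexpg val1; exact: E_t_order.
case=> ->; rewrite ?gmulfM !hom_zexpg /= !free_lift_gen /nu_gen //=.
rewrite -!zexpgM -!zexpgD.
have -> : (f * r + A + f * - s + - A = f * (r - s))%R.
  by rewrite mulrBr mulrN addrAC addrK.
move/eqP: hf; rewrite eqz_mod_dvd subr0 => /dvdzP[q ->].
by rewrite mulrC zexpgM tn; case: q => k /=; rewrite expg1n ?invg1.
Qed.

Definition nu : {hom E_group -> subg_of (cycleg E_t)} := pres_lift nu_relators.

Lemma nu_t : nu E_t = cycleg_gen E_t.
Proof. by rewrite /nu /= pres_lift_gen. Qed.

Lemma nu_y : nu E_y = zexpg (cycleg_gen E_t) f.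
Proof. by rewrite /nu /= pres_lift_gen. Qed.

Lemma nu_retraction c : nu (val c) = c.
Proof.
case: c => c c_t; have /cyclegP[k ck] := c_t; apply: val_inj.
by rewrite [val (exist _ _ _)]/= ck hom_zexpg nu_t hom_zexpg.
Qed.

End Retraction.
End TheGroup.

(* Main.v *)
Require Import Defs.
From HB Require Import structures.
From mathcomp Require Import all_boot all_order all_algebra.
From mathcomp Require Import boolp classical_sets functions cardinality.
From mathcomp Require Import perm zify ring.

Set Implicit Arguments.
Unset Strict Implicit.
Unset Printing Implicit Defensive.

Import Order.TTheory GRing.Theory Num.Theory.

Local Open Scope classical_set_scope.
Local Open Scope quotient_scope.
Local Open Scope group_scope.

(** Killing y maps E onto the cyclic group <t> of order n.  With
    d = gcd(n, A) and m = n / d, the kernel M of this map is the free product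
    of d copies of
      N = < y_0, ..., y_(m-1) | y_i ^ r = y_(i+1) ^ s >   (i modulo m),
    where y_i is the conjugate of y by t ^ (i A).  The proof decides when M is
    small; this depends on g = gcd(r, s).

    - If n = 1, then E is cyclic.

    - If n > 1 and g <> 1, adding the relation y ^ g = 1 maps E onto the free
      product Z_n * Z_g, where Z_0 is infinite cyclic; this free product is
      large unless n = g = 2.  For n = g = 2 and A even,
      E = Z_2 * Z_|r - s|, which is dihedral if |r - s| = 2 and large
      otherwise; for n = g = 2 and A odd, y ^ 2 generates a normal cyclic
      subgroup with dihedral quotient.

    - If n > 1 and g = 1, going once around the relations gives y ^ K = 1 with
      K = r ^ m - s ^ m.  As K is coprime to r and s, the cyclic groups <y_i>
      coincide and N is cyclic of order |K|.  So M is cyclic if d = 1, trivial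
      if |K| = 1, infinite dihedral if d = |K| = 2, and otherwise a free
      product of d copies of Z_|K| that is virtually free and not virtually
      cyclic.

    The three virtually abelian families are covered by
    [commuting_gen_virtually_abelian], [normal_cycle_virtually_abelian] and
    [dihedral_virtually_abelian].

    Largeness is proved by exhibiting a covering.  A homomorphism from a group
    to the wreath product of F_2 with the permutations of a finite set Q is an
    action on Q in which every move carries a label in F_2; the labels read
    along the loops at a base point give a homomorphism from a finite-index
    subgroup to F_2 ([large_stab]).  For E the set Q is a torus Z_n x Z_k, t
    translating the first coordinate and y the second one
    ([E_large_torus]).  The labels are trivial on t and a coboundary w on y,
    so that the relations of E reduce to conditions on the two permutations
    and on w.

    Finally G contains the n-th powers of the elements of E, and a subgroup
    containing all e-th powers of a large group is large ([large_powers]),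
    again by a labelled action, of F_2 on a cycle of length e. *)

(** * Subgroups and finite index *)

Definition subgroup (G : groupType) (P : G -> Prop) : Prop :=
  P 1 /\ forall x y, P x -> P y -> P (x * y^-1).

Section SubgroupPred.
Variables (G : groupType) (P : G -> Prop) (PG : subgroup P).

Lemma subgroupV x : P x -> P x^-1.
Proof. by case: PG => P1 PF Px; rewrite -[x^-1]mul1g; apply: PF. Qed.

Lemma subgroupM x y : P x -> P y -> P (x * y).
Proof. by move=> Px /subgroupV Py; rewrite -[y]invgK; apply: PG.2. Qed.

Definition subgroup_pred of subgroup P : {pred G} := [pred x | `[<P x>]].

Lemma subgroup_predP x : reflect (P x) (x \in subgroup_pred PG).
Proof. exact: asboolP. Qed.

Fact subgroup_pred_invg : invg_closed (subgroup_pred PG).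
Proof. by move=> x /subgroup_predP Px; apply/subgroup_predP/subgroupV. Qed.
Fact subgroup_pred1 : 1 \in subgroup_pred PG.
Proof. by apply/subgroup_predP; case: PG. Qed.
Fact subgroup_pred_mulg : mulg_closed (subgroup_pred PG).
Proof.
by move=> x y /subgroup_predP Px /subgroup_predP Py; apply/subgroup_predP/subgroupM.
Qed.
HB.instance Definition _ :=
  isMulClosed.Build G (subgroup_pred PG) subgroup_pred_mulg.
HB.instance Definition _ :=
  isMul1Closed.Build G (subgroup_pred PG) subgroup_pred1.
HB.instance Definition _ :=
  isInvClosed.Build G (subgroup_pred PG) subgroup_pred_invg.

End SubgroupPred.

Lemma groupClosed_subgroup (G : groupType) (H : groupClosed G) :
  subgroup (fun x => x \in H).
Proof. by split=> [|x y xH yH]; [exact: gpred1 | exact: gpredF]. Qed.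

Section FiniteIndex.
Variables (G : groupType).

(** Finitely many cosets amount to a finite colouring that separates them.
    Colourings, unlike sets of cosets, combine and restrict easily. *)
Lemma finite_indexP (H : {pred G}) : 1 \in H ->
  finite_index H ->
  exists (Q : finType) (c : G -> Q), forall x y, c x = c y -> x^-1 * y \in H.
Proof.
move=> H1 /finite_seqP[s sE].
pose coset x := [set x * h | h in [set` H]].
have coset_s x : coset x \in s.
  have : [set` s] (coset x) by rewrite -sE; exists x.
  by [].
exists 'I_(size s).+1, (fun x => inord (index (coset x) s)) => x y.
have lt z : index (coset z) s < (size s).+1 by rewrite ltnS index_size.
move=> /(congr1 val) /=; rewrite !inordK //.
move=> /(congr1 (nth (coset x) s)); rewrite !nth_index // => exy.
have : coset y y by exists 1; rewrite ?mulg1.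
by rewrite -exy => -[h hH <-]; rewrite mulKg.
Qed.

Lemma finite_index_colour (H : groupClosed G) (Q : finType) (c : G -> Q) :
  (forall x y, c x = c y -> x^-1 * y \in H) -> finite_index H.
Proof.
move=> cH; pose coset x := [set x * h | h in [set` H]].
have [D Dc] : {D : Q -> set G & forall q, forall x, c x = q -> coset x = D q}.
  apply: (@choice _ _ (fun q X => forall x, c x = q -> coset x = X)) => q.
  have [[x xq]|nq] := pselect (exists x, c x = q); last first.
    by exists set0 => x xq; case: nq; exists x.
  exists (coset x) => y yq; have xy : x^-1 * y \in H by apply: cH; rewrite xq.
  apply/seteqP; split=> _ [h /= hH <-]; rewrite /coset /=.
    by exists (x^-1 * y * h); [exact: gpredM | rewrite !mulgA mulgV mul1g].
  exists (y^-1 * x * h); last by rewrite !mulgA mulgV mul1g.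
  by rewrite /=; apply: gpredM => //; rewrite -[y^-1 * x]invgK invgM invgK gpredV.
apply: (@sub_finite_set _ _ (range D)); last exact: finite_image.
by move=> _ [x _ <-]; exists (c x) => //; rewrite -(Dc _ x erefl).
Qed.

(** The representatives are those of right cosets, whereas the index is
    defined by left ones: hence the inverses. *)
Lemma finite_index_reps (H : groupClosed G) (cs : seq G) :
  (forall g, exists2 c, c \in cs & g * c^-1 \in H) -> finite_index H.
Proof.
move=> csH.
have [i iP] : {i : G -> 'I_(size cs).+1 &
    forall x, x^-1 * (nth 1 cs (i x))^-1 \in H}.
  apply: (@choice _ _ (fun x i => x^-1 * (nth 1 cs (val i))^-1 \in H)) => x.
  have [c ccs xc] := csH x^-1.
  exists (inord (index c cs)); rewrite /= inordK ?ltnS ?index_size //.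
  by rewrite nth_index.
apply: (@finite_index_colour H _ i) => x y ixy.
have := gpredF (iP x) (iP y); rewrite ixy.
by rewrite !invgM !invgK !mulgA mulgVK.
Qed.

End FiniteIndex.

(** * Large groups *)

Lemma free_group_ind (X : choiceType) (P : free_group X -> Prop) :
  P 1 -> (forall a x, P a -> P (a * free_gen x)) ->
  (forall a x, P a -> P (a * (free_gen x)^-1)) -> forall a, P a.
Proof.
move=> P1 PM PV; elim/quotW; elim/last_ind => [|w [x b] IH]; first exact: P1.
have pi_cat u v : \pi_(free_group X) (u ++ v) =
    (\pi_(free_group X) u : free_group X) * \pi_(free_group X) v.
  apply: (free_pi_eq _ _).1; apply: free_eq_sym.
  exact: free_eq_cat (free_eq_repr _) (free_eq_repr _).
rewrite -cats1 pi_cat; case: b; first exact: PM.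
suff -> : (\pi_(free_group X) [:: (x, false)] : free_group X) = (free_gen x)^-1.
  exact: PV.
apply: (mulIg (free_gen x)); rewrite mulVg -pi_cat.
apply: (free_pi_eq _ _).1; exact: (free_eq_cancel [::] [::] x false).
Qed.

Lemma I2P (P : 'I_2 -> Prop) : P ord0 -> P ord_max -> forall i, P i.
Proof.
move=> P0 P1 i; have [->//|i0] := eqVneq i ord0.
suff -> : i = ord_max by [].
by apply: val_inj => /=; case: i i0 => -[|[|]].
Qed.

Lemma hom_free_surj (K : groupType) (X : choiceType)
    (phi : {hom K -> free_group X}) :
  (forall b, exists x, phi x = free_gen b) -> range phi = setT.
Proof.
move=> phiX; apply/seteqP; split=> // a _.
elim/free_group_ind: a => [|a b [x _ <-]|a b [x _ <-]].
- by exists 1; rewrite ?gmulf1.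
- by have [z <-] := phiX b; exists (x * z); rewrite ?gmulfM.
- by have [z <-] := phiX b; exists (x * z^-1); rewrite ?gmulfM ?gmulfV.
Qed.

Section LargeHom.
Variables (G : groupType) (H : groupClosed G) (f : G -> free_group 'I_2).
Hypothesis fM : {in H &, {morph f : x y / x * y}}.
Let fH (x : subg_of H) := f (val x).
Fact fH_morph : monoid.monoid_morphism fH.
Proof.
have fHM : {morph fH : x y / x * y}.
  by move=> x y; rewrite /fH gmulfM fM //; apply: valP.
split=> //; by apply: (mulIg (fH 1)); rewrite -fHM !mul1g.
Qed.
HB.instance Definition _ :=
  isUMagmaMorphism.Build (subg_of H) (free_group 'I_2) fH fH_morph.
Definition restr_hom : {hom subg_of H -> free_group 'I_2} := fH.
End LargeHom.

(** The map is defined on the whole group, so that [large] can be handled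
    without the subtype of a subgroup. *)
Definition large_witness (G : groupType) (P : G -> Prop)
    (f : G -> free_group 'I_2) : Prop :=
  [/\ subgroup P,
      forall x y, P x -> P y -> f (x * y) = f x * f y &
      forall b, exists2 x, P x & f x = free_gen b].

Lemma largeI (G : groupType) (P : G -> Prop) f (Q : finType) (c : G -> Q) :
  large_witness P f -> (forall x y, c x = c y -> P (x^-1 * y)) -> large G.
Proof.
move=> [PG fM fX] cP; pose H : groupClosed G := subgroup_pred PG.
exists H.
  by apply: (@finite_index_colour _ _ _ c) => x y /cP xyP; exact/(subgroup_predP PG).
have fH : {in H &, {morph f : x y / x * y}}.
  by move=> x y /(subgroup_predP PG) Px /(subgroup_predP PG) Py; apply: fM.
exists (restr_hom fH); apply: hom_free_surj => b.
have [x /(subgroup_predP PG) xH <-] := fX b.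
by exists (exist _ x xH).
Qed.

Lemma largeE (G : groupType) : large G ->
  exists (P : G -> Prop) f (Q : finType) (c : G -> Q),
    large_witness P f /\ forall x y, c x = c y -> P (x^-1 * y).
Proof.
case=> H fiH [phi phiT].
have [Q [c cP]] := finite_indexP (gpred1 (s := H)) fiH.
pose f x : free_group 'I_2 :=
  if insub x is Some h then phi (h : subg_of H) else 1.
have fE (h : subg_of H) : f (val h) = phi h by rewrite /f valK.
exists (fun x => x \in H), f, Q, c; split=> //.
split; first exact: groupClosed_subgroup.
  move=> x y xH yH.
  rewrite -[x]/(val (exist _ x xH : subg_of H)).
  by rewrite -[y]/(val (exist _ y yH : subg_of H)) -valM !fE gmulfM.
move=> b; have : range phi (free_gen b) by rewrite phiT.
by case=> h _ <-; exists (val h); [apply: valP | rewrite fE].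
Qed.

(** * Labelled permutations and largeness *)

Section Wreath.
Variables (F : groupType) (Q : finType).

(** The pair [(w, s)] acts on the copies of F indexed by Q: from q it moves to
    [s q] along an edge labelled [w q].  Products read from left to right, as
    for permutations. *)
Definition wreath : Type := ({ffun Q -> F} * {perm Q})%type.
HB.instance Definition _ := Choice.on wreath.

Definition wmk (w : {ffun Q -> F}) (s : {perm Q}) : wreath := (w, s).
Definition volt (a : wreath) : {ffun Q -> F} := a.1.
Definition wperm (a : wreath) : {perm Q} := a.2.

Lemma wreathP (a b : wreath) :
  (forall q, volt a q = volt b q) -> (forall q, wperm a q = wperm b q) -> a = b.
Proof.
case: a b => [u s] [v t] /= uv st; congr pair; first exact/ffunP.
exact/permP.
Qed.

Definition wmul (a b : wreath) : wreath :=
  wmk [ffun q => volt a q * volt b (wperm a q)] (wperm a * wperm b).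
Definition wone : wreath := wmk [ffun=> 1] 1.
Definition winv (a : wreath) : wreath :=
  wmk [ffun q => (volt a ((wperm a)^-1%g q))^-1] (wperm a)^-1.

Fact wmulA : associative wmul.
Proof.
move=> a b c; apply: wreathP => q /=; last by rewrite !permM.
by rewrite !ffunE /= permM mulgA.
Qed.
Fact wmul1 : left_id wone wmul.
Proof.
by move=> a; apply: wreathP => q /=; rewrite ?permM ?ffunE ?perm1 /= ?mul1g.
Qed.
Fact wmul1r : right_id wone wmul.
Proof.
by move=> a; apply: wreathP => q /=; rewrite ?permM ?ffunE ?perm1 /= ?mulg1.
Qed.
Fact wmulV : left_inverse wone winv wmul.
Proof.
move=> a; apply: wreathP => q /=; last by rewrite permM permKV perm1.
by rewrite !ffunE /= mulVg.
Qed.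
Fact wmulVr : right_inverse wone winv wmul.
Proof.
move=> a; apply: wreathP => q /=; last by rewrite permM permK perm1.
by rewrite !ffunE /= permK mulgV.
Qed.
HB.instance Definition _ := isGroup.Build wreath wmulA wmul1 wmul1r wmulV wmulVr.

Lemma voltM (a b : wreath) q : volt (a * b) q = volt a q * volt b (wperm a q).
Proof. by rewrite ffunE. Qed.
Lemma voltV (a : wreath) q : volt a^-1 q = (volt a ((wperm a)^-1 q))^-1.
Proof. by rewrite ffunE. Qed.

Fact wperm_morph : monoid.monoid_morphism wperm.
Proof. by []. Qed.
HB.instance Definition _ :=
  isUMagmaMorphism.Build wreath {perm Q} wperm wperm_morph.

Lemma wpermM (a b : wreath) q : wperm (a * b) q = wperm b (wperm a q).
Proof. by rewrite permM. Qed.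

Definition wlift (s : {perm Q}) : wreath := wmk [ffun=> 1] s.
Fact wlift_morph : monoid.monoid_morphism wlift.
Proof. by split=> // s t; apply: wreathP => q //=; rewrite !ffunE mulg1. Qed.
HB.instance Definition _ :=
  isUMagmaMorphism.Build {perm Q} wreath wlift wlift_morph.

Lemma wliftM s t : wlift (s * t) = wlift s * wlift t.
Proof. exact: gmulfM. Qed.

Lemma volt_lift s q : volt (wlift s) q = 1. Proof. by rewrite ffunE. Qed.

(** Conjugation by [gauge w] changes labels by the coboundary of w: it does not
    alter the label of a loop at a point where w is trivial. *)
Definition gauge (w : Q -> F) : wreath := wmk (finfun w) 1.
Lemma volt_gauge w q : volt (gauge w) q = w q. Proof. by rewrite ffunE. Qed.
Lemma wperm_gauge w q : wperm (gauge w) q = q. Proof. by rewrite perm1. Qed.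

End Wreath.

(** The stabiliser of q has finite index, and on it the label at q is
    multiplicative. *)
Lemma large_stab (G : groupType) (Q : finType)
    (phi : {hom G -> wreath (free_group 'I_2) Q}) q :
  (forall b, exists x, wperm (phi x) q = q /\ volt (phi x) q = free_gen b) ->
  large G.
Proof.
move=> phiX.
have wV x : wperm (phi x^-1) = (wperm (phi x))^-1 by rewrite !gmulfV.
apply: (@largeI G (fun x => wperm (phi x) q = q) (fun x => volt (phi x) q) _
  (fun x => wperm (phi x^-1))); last first.
  move=> x y exy; rewrite gmulfM wpermM exy wV.
  by rewrite permKV.
split; first split.
- by rewrite gmulf1 perm1.
- by move=> x y xq yq; rewrite gmulfM wpermM xq wV -{1}yq permK.
- by move=> x y xq _; rewrite gmulfM voltM xq.
- by move=> b; have [x [xq xb]] := phiX b; exists x.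
Qed.

Section Cyclic.
Variables (F : groupType) (e : nat).
Notation C := 'I_e.+1.

Definition ord_shift : {perm C} := perm (@ordS_inj e.+1).
(** One turn of the cycle carries the label x, all of it on a single edge. *)
Definition wrap (x : F) : wreath F C :=
  wmk [ffun q => if q == ord_max then x else 1] ord_shift.

(** The e.+1-st power makes one full turn from every starting point, so it
    fixes all points and reads x once. *)
Lemma wrap_expg x : wrap x ^+ e.+1 = wmk [ffun=> x] 1.
Proof.
have shE q : val (ord_shift q) = (q.+1 %% e.+1)%N.
  by rewrite permE.
(* k moves from i stay below the wrapping edge exactly when i + k <= e. *)
have H k (i : C) : (k <= e.+1)%N ->
    val (wperm (wrap x ^+ k) i) = ((i + k) %% e.+1)%N /\
    volt (wrap x ^+ k) i = if (i + k <= e)%N then 1 else x.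
  elim: k => [|k IH] kle.
    by rewrite addn0 /= perm1 modn_small // -ltnS ltn_ord ffunE.
  have [IHp IHv] := IH (ltnW kle).
  rewrite expgSr wpermM voltM IHv; split.
    by rewrite shE IHp -addn1 modnDml addn1 addnS.
  rewrite ffunE -(inj_eq val_inj) IHp /= addnS.
  have := ltn_ord i; case: ifP => ik il.
    rewrite modn_small // mul1g; case: eqP => ike; case: ifP => //; lia.
  rewrite ifF; first by rewrite ifF ?mulg1 //; lia.
  rewrite -[(i + k)%N](@subnK e.+1) ?modnDr; last by lia.
  by rewrite modn_small; lia.
apply: wreathP => q.
  have [_ ->] := H e.+1 q (leqnn _).
  by rewrite ffunE ifF //; lia.
rewrite perm1; apply: val_inj; have [-> _] := H e.+1 q (leqnn _).
by rewrite modnDr modn_small.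
Qed.

End Cyclic.

(** Let f map a finite-index subgroup P onto F_2.  The images of the e-th
    powers need not generate F_2, but the labelled action of F_2 on a cycle of
    length e, in which both generators rotate the cycle and are labelled by
    themselves once per turn, sends the e-th power of a generator to the label
    of that generator. *)
Lemma large_powers (G : groupType) (K : groupClosed G) (e : nat) :
  (0 < e)%N -> (forall x, x ^+ e \in K) -> large G -> large (subg_of K).
Proof.
case: e => // e _ Ke /largeE[P [f [Q [c [[PG fM fX] cP]]]]].
pose psi : {hom free_group 'I_2 -> wreath (free_group 'I_2) 'I_e.+1} :=
  free_lift (fun b => wrap e (free_gen b)).
have P1 := PG.1.
have f1 : f 1 = 1 by apply: (mulIg (f 1)); rewrite -fM // !mul1g.
have PV := subgroupV PG; have PM := subgroupM PG.
have fV x : P x -> f x^-1 = (f x)^-1.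
  by move=> Px; apply: (mulIg (f x)); rewrite -fM ?mulVg //; apply: PV.
have wV x : P x -> wperm (psi (f x^-1)) = (wperm (psi (f x)))^-1.
  by move=> Px; rewrite fV // gmulfV.
(* Colour x first by its coset of P and then, after bringing it back into P
   by a representative of the coset, by the rotation of the cycle. *)
have [rep repP] : {rep : Q -> G & forall x, c (rep (c x)) = c x}.
  have [|rep repP] := @choice Q G (fun q y => forall x, c x = q -> c y = q).
    move=> q; have [[x xq]|nq] := pselect (exists x, c x = q); first by exists x.
    by exists 1 => x xq; case: nq; exists x.
  by exists rep => x; apply: repP.
have repK x : P (x^-1 * rep (c x)) by apply: cP; rewrite repP.
apply: (@largeI _
  (fun x : subg_of K => P (val x) /\ wperm (psi (f (val x))) ord0 = ord0)
  (fun x => volt (psi (f (val x))) ord0) _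
  (fun x => (c (val x), wperm (psi (f ((val x)^-1 * rep (c (val x)))))))).
  split; first split.
  - by rewrite gmulf1 f1 gmulf1 perm1.
  - move=> x y [Px x0] [Py y0]; rewrite gmulfM gmulfV; split; first exact: PG.2.
    by rewrite fM ?gmulfM ?wpermM ?x0 ?wV -1?{1}y0 ?permK //; apply: PV.
  - by move=> x y [Px x0] [Py y0]; rewrite gmulfM fM // gmulfM voltM x0.
  - move=> b; have [x Px xb] := fX b.
    have fXn k : P (x ^+ k) /\ f (x ^+ k) = free_gen b ^+ k.
      elim: k => [|k [IHP IHf]]; first by split; rewrite ?f1.
      by rewrite !expgS; split; [exact: PM | rewrite fM // IHf xb].
    have [Pxe fxe] := fXn e.+1.
    have psib : psi (free_gen b ^+ e.+1) = wmk [ffun=> free_gen b] 1.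
      by rewrite gmulfXn /= free_lift_gen wrap_expg.
    exists (exist (fun x => x \in K) _ (Ke x)); rewrite [val _]/= fxe psib.
      by rewrite perm1.
    by rewrite ffunE.
move=> x y [cxy pxy]; rewrite gmulfM gmulfV.
have -> : (val x)^-1 * val y =
    ((val x)^-1 * rep (c (val x))) * ((val y)^-1 * rep (c (val y)))^-1.
  by rewrite cxy invgM invgK !mulgA mulgK.
split; first exact: PG.2.
by rewrite fM ?gmulfM ?wpermM ?pxy ?wV ?permK //; apply: PV.
Qed.

(** * Integer powers *)

Section ZPower.
Variable G : groupType.
Implicit Types (x g : G) (m k : int).

Lemma zexpgJ x g m : zexpg (x ^ g) m = zexpg x m ^ g.
Proof. by case: m => k /=; rewrite ?conjVg -conjXg. Qed.

Lemma zexp1g m : zexpg (1 : G) m = 1.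
Proof. by case: m => k /=; rewrite expg1n ?invg1. Qed.

Lemma zexpg_mod x n m : zexpg x n = 1 -> zexpg x (m %% n)%Z = zexpg x m.
Proof.
move=> xn; have [q] : exists q, m = (n * q + (m %% n)%Z)%R.
  by exists (m %/ n)%Z; rewrite mulrC -divz_eq.
by move: (m %% n)%Z => p ->; rewrite zexpgD zexpgM xn zexp1g mul1g.
Qed.

Lemma zexpg_nat x n m : (0 < n)%R -> zexpg x n = 1 ->
  zexpg x m = x ^+ `|(m %% n)%Z|.
Proof.
move=> n0 xn; rewrite -(zexpg_mod m xn).
by have := modz_ge0 m (lt0r_neq0 n0); case: (m %% n)%Z.
Qed.

Lemma zexpgC x m k : commute (zexpg x m) (zexpg x k).
Proof. by rewrite /commute -!zexpgD addrC. Qed.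

End ZPower.

Lemma commute_zexp (G : groupType) (x y : G) m k :
  commute x y -> commute (zexpg x m) (zexpg y k).
Proof.
have half (a b : G) i : commute a b -> commute a (zexpg b i).
  by move=> ab; case: i => i /=; [|apply: commuteV]; apply: commuteX.
by move=> xy; apply/half/commute_sym/half/commute_sym.
Qed.

Lemma zexpg_absz (G : groupType) (x : G) (z : int) :
  zexpg x z = 1 -> x ^+ `|z|%N = 1.
Proof. by case: z => k //= xk; apply: invg_inj; rewrite invg1. Qed.

Lemma zexpg_odd (G : groupType) (x : G) (m : int) :
  x * x = 1 -> odd `|m| -> zexpg x m = x.
Proof.
move=> xx m1; have [q ->] : exists q, m = (Posz 2 * q + 1)%R.
  by exists (m %/ 2)%Z; lia.
by rewrite zexpgD zexpgM [zexpg x 2]xx zexp1g mul1g.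
Qed.

Lemma expg_modn (G : groupType) (x : G) N i : x ^+ N = 1 -> x ^+ (i %% N) = x ^+ i.
Proof.
move=> xN; rewrite [in RHS](divn_eq i N) expgnDr mulnC expgnA xN expg1n.
by rewrite mul1g.
Qed.

(** * Labelled actions of E *)

Section Presentation.
Variables r n s A : int.
Notation E := (E_group r n s A).
Notation t := (E_t r n s A).
Notation y := (E_y r n s A).

Lemma E_rel : zexpg y r * zexpg t A = zexpg t A * zexpg y s.
Proof.
have /pres_pi_rel : E_relators r n s A (zexpg free_y r * zexpg free_t A
         * zexpg free_y (- s)%R * zexpg free_t (- A)%R) by right.
rewrite !gmulfM /= !hom_zexpg /= !zexpgN => /divg1_eq Erel.
by rewrite -[X in _ = X * _]Erel mulgVK.
Qed.

Lemma E_ind (P : E -> Prop) :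
    P 1 -> (forall x, P x -> P (x * t)) -> (forall x, P x -> P (x * t^-1)) ->
    (forall x, P x -> P (x * y)) -> (forall x, P x -> P (x * y^-1)) ->
  forall x, P x.
Proof.
move=> P1 Pt PtV Py PyV; elim/quotW => x; rewrite -/(pres_pi _ x).
elim/free_group_ind: x => [|x i|x i]; first by rewrite gmulf1.
  by rewrite gmulfM; elim/I2P: i; [apply: Pt | apply: Py].
by rewrite gmulfM gmulfV; elim/I2P: i; [apply: PtV | apply: PyV].
Qed.

Lemma E_hom (H : groupType) (t' y' : H) : zexpg t' n = 1 ->
  zexpg y' r * zexpg t' A = zexpg t' A * zexpg y' s ->
  exists phi : {hom E -> H}, phi t = t' /\ phi y = y'.
Proof.
move=> tn yt; pose g (i : 'I_2) := if i == ord0 then t' else y'.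
have gR x : E_relators r n s A x -> free_lift g x = 1.
  case=> ->; rewrite ?gmulfM !hom_zexpg /= !free_lift_gen /g //=.
  by rewrite yt !zexpgN mulgK mulgV.
by exists (pres_lift gR); rewrite /= !pres_lift_gen.
Qed.

(** Send t to T with trivial labels and y to the conjugate of Y by [gauge w].
    The relation of E survives the conjugation when w is constant along the
    moves of T ^ A, because T ^ A is then equal to its own conjugate; it also
    survives if Y ^ r and Y ^ s are both trivial.  The loops used are those of the
    elements t ^ i y ^ j t ^ -i y ^ -j. *)
Lemma E_large_perm (Q : finType) (T Y : {perm Q}) (w : Q -> free_group 'I_2) q0 :
    zexpg T n = 1 -> zexpg Y r * zexpg T A = zexpg T A * zexpg Y s ->
    (forall q, w (zexpg T A q) = w q) \/ zexpg Y r = 1 /\ zexpg Y s = 1 ->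
    (forall b, exists i j : nat,
       let q1 := (T ^+ i)%g q0 in let q2 := (Y ^+ j)%g q1 in
       let q3 := (T ^- i)%g q2 in
       (Y ^- j)%g q3 = q0 /\
       (w q1)^-1 * w q2 * ((w q3)^-1 * w q0) = free_gen b) ->
  large E.
Proof.
move=> Tn YT wT loops.
pose F := free_group 'I_2; pose W : wreath F Q := gauge w.
have [||phi [phit phiy]] := E_hom (t' := wlift F T) (y' := wlift F Y ^ W).
- by rewrite -hom_zexpg Tn gmulf1.
- rewrite !zexpgJ -!hom_zexpg; case: wT => [wT|[-> ->]]; last first.
    by rewrite gmulf1 conj1g mul1g mulg1.
  have WT : wlift F (zexpg T A) ^ W = wlift F (zexpg T A).
    apply: (mulgI W); rewrite -conjgC; apply: wreathP => q.
      by rewrite !voltM !volt_lift !volt_gauge wT mulg1 mul1g.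
    by rewrite !wpermM !wperm_gauge.
  suff : wlift F (zexpg Y r) ^ W * wlift F (zexpg T A) =
      wlift F (zexpg T A) * wlift F (zexpg Y s) ^ W by [].
  by rewrite -{1}WT -conjMg -wliftM YT wliftM conjMg WT.
apply: (large_stab (phi := phi) (q := q0)) => b.
have [i [j [Yq wq]]] := loops b.
exists (t ^+ i * y ^+ j * t ^- i * y ^- j).
rewrite !gmulfM !gmulfV !gmulfXn phit phiy -!conjXg -!gmulfXn -conjVg -!gmulfV.
rewrite /conjg !(wpermM, voltM, voltV, volt_lift, volt_gauge, wperm_gauge) /=.
rewrite !(invg1, perm1, mul1g).
rewrite !mulg1 !permM permKV Yq; split=> //.
by rewrite invgM invgK -wq.
Qed.

Local Notation torus n' k' := ('I_n'.+1 * 'I_k'.+2)%type.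

(** In row i of the torus, y translates by [c i]; the relation of E asks
    that the steps satisfy r c_i = s c_(i + A).  The labels w depend on the row
    only modulo d, hence are constant along T ^ A when d divides A.  In the
    rows below d the steps are 1; as w is trivial on row 0 and on column 0, the
    loop around the rectangle with
    opposite corners (0, 0) and (i, j) reads w (i, j), and a d x k rectangle
    other than 2 x 2 has two such corners to carry the two generators. *)
Lemma E_large_torus n' k' d (c : nat -> 'I_k'.+2) :
    n = n'.+1 -> (d %| n'.+1)%N -> (1 < d)%N -> (2 < d)%N || (0 < k')%N ->
    (forall i, (i < d)%N -> c i = 1%R) ->
    let a := `|(A %% n)%Z| in
    (d %| a)%N /\ (forall i, (i <= n')%N ->
                      (c i *~ r)%R = (c ((i + a) %% n'.+1)%N *~ s)%R)
    \/ (k'.+2%:Z %| r)%Z /\ (k'.+2%:Z %| s)%Z ->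
  large E.
Proof.
move=> nE d_n d1 dk c1 a ac.
have T_inj : injective (fun q : torus n' k' => (ordS q.1, q.2)).
  move=> [i j] [i1 j1] eij.
  by congr pair; [apply: ordS_inj (congr1 fst eij) | apply: (congr1 snd eij)].
have Y_inj : injective (fun q : torus n' k' => (q.1, q.2 + c q.1)%R).
  move=> [i j] [i1 j1] /= eij; have /= i_i1 := congr1 fst eij.
  have /= := congr1 snd eij; rewrite i_i1 => j_j1.
  by congr pair; apply: (addIr _ j_j1).
pose T : {perm torus n' k'} := perm T_inj; pose Y : {perm torus n' k'} := perm Y_inj.
have TE k q : (T ^+ k) q = (inord ((q.1 + k) %% n'.+1)%N, q.2) :> torus n' k'.
  elim: k => [|k IH].
    rewrite perm1 addn0 modn_small //; case: q => i j /=.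
    by congr pair; apply: val_inj; rewrite /= inordK.
  rewrite expgSr permM IH permE /=; congr pair; apply: val_inj => /=.
  by rewrite !inordK ?ltn_mod // -addn1 modnDml addn1 addnS.
have YE m q : (zexpg Y m) q = (q.1, q.2 + c q.1 *~ m)%R.
  have YV q' : Y^-1%g q' = (q'.1, q'.2 - c q'.1)%R.
    apply: (perm_inj (s := Y)); rewrite permKV permE /= subrK.
    by case: q'.
  elim: m => [|m IH|m IH].
  - by rewrite perm1 mulr0z addr0; case: q.
  - by rewrite -(addn1 m) PoszD zexpgS permM IH permE /= mulrzDr addrA.
  - rewrite -(addn1 m) PoszD opprD zexpgB1 permM IH YV /=.
    by rewrite mulrzBr addrA.
have Tn : zexpg T n = 1.
  rewrite nE; apply/permP => q; rewrite [zexpg _ _]/= TE perm1 modnDr.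
  rewrite modn_small //; case: q => i j /=.
  by congr pair; apply: val_inj; rewrite /= inordK.
have TA : zexpg T A = T ^+ a by apply: zexpg_nat Tn; rewrite nE.
pose v (i j : nat) : free_group 'I_2 :=
  if (i == 0)%N || (j == 0)%N then 1
  else if (i == 1%N) && (j == 1)%N then free_gen ord0 else free_gen ord_max.
pose w (q : torus n' k') := v (q.1 %% d)%N q.2.
have mod_d i : ((i %% n'.+1) %% d = i %% d)%N by rewrite modn_dvdm.
have kz m (z : 'I_k'.+2) : (k'.+2%:Z %| m)%Z -> (z *~ m = 0)%R.
  move=> /dvdzP[u ->]; rewrite mulrC mulrzA -pmulrn Zp_mulrn.
  by rewrite (_ : inZp _ = 0%R) ?mul0rz //; apply: val_inj; rewrite /= modnMl.
apply: (@E_large_perm _ T Y w (ord0, ord0)) => //.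
- rewrite TA; apply/permP => q; rewrite !permM !YE !TE /=.
  congr pair; rewrite inordK ?ltn_mod //.
  case: ac => [[_ ac]|[kr ks]]; last by rewrite !kz.
  by rewrite ac // -ltnS.
- case: ac => [[da _]|[kr ks]].
    left=> q; rewrite TA TE /w /= inordK ?ltn_mod // mod_d.
    by rewrite -modnDmr (eqP da) addn0.
  right; split; apply/permP => q; rewrite YE perm1 kz // addr0; by case: q.
have loop i j b : (i < d)%N -> (j < k'.+2)%N -> v i j = free_gen b ->
    exists i j : nat,
      let q1 := (T ^+ i)%g (ord0, ord0) in let q2 := (Y ^+ j)%g q1 in
      let q3 := (T ^- i)%g q2 in
      (Y ^- j)%g q3 = (ord0, ord0) /\
      (w q1)^-1 * w q2 * ((w q3)^-1 * w (ord0, ord0)) = free_gen b.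
  move=> id jk vij; exists i, j.
  have i_n : (i < n'.+1)%N by apply: leq_trans id _; exact: dvdn_leq.
  have Ti l : (T ^+ i)%g (ord0, l) = (inord i, l).
    by rewrite TE add0n modn_small.
  have Yj (l : 'I_n'.+1) : (l < d)%N -> (Y ^+ j)%g (l, ord0) = (l, inord j).
    move=> ld; rewrite -[Y ^+ j]/(zexpg Y j) YE /= c1 //; congr pair.
    rewrite add0r -pmulrn; apply: val_inj.
    by rewrite /= inordK // Zp_nat /= modn_small.
  have TVi l : (T ^- i)%g (inord i, l) = (ord0, l) by rewrite -Ti permK.
  have d0 : (0 < d)%N by exact: ltnW.
  have YVj : (Y ^- j)%g (ord0, inord j) = (ord0, ord0) by rewrite -Yj ?permK.
  rewrite /= Ti Yj ?inordK // TVi YVj; split=> //.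
  rewrite /w /= !inordK // mod0n !(modn_small id) /v /= orbT.
  by rewrite /v in vij; rewrite invg1 mul1g !mulg1 vij.
elim/I2P; first by apply: (loop 1%N 1%N).
by case/orP: dk => dk; [apply: (loop 2 1)%N | apply: (loop 1 2)%N].
Qed.

End Presentation.

(** * Virtually abelian groups *)

Lemma virtually_abelianI (G : groupType) (P : G -> Prop) (cs : seq G) :
    subgroup P -> (forall x y, P x -> P y -> commute x y) ->
    (forall g, exists2 c, c \in cs & P (g * c^-1)) ->
  virtually_abelian G.
Proof.
move=> PG Pab Pcs; pose H : groupClosed G := subgroup_pred PG; exists H.
  apply: (finite_index_reps (cs := cs)) => g; have [c ccs gc] := Pcs g.
  by exists c => //; apply/(subgroup_predP PG).
by move=> x y /(subgroup_predP PG) Px /(subgroup_predP PG) Py; apply: Pab.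
Qed.

Lemma virtually_abelian_subgroup (G : groupType) (K : groupClosed G) :
  virtually_abelian G -> virtually_abelian (subg_of K).
Proof.
case=> H fiH Hab; have [Q [c cH]] := finite_indexP (gpred1 (s := H)) fiH.
pose P (x : subg_of K) := val x \in H.
have PG : subgroup P.
  split=> [|x y]; first by rewrite /P gmulf1 gpred1.
  by rewrite /P gmulfM gmulfV; apply: gpredF.
pose HK : groupClosed (subg_of K) := subgroup_pred PG; exists HK.
  apply: (finite_index_colour (c := c \o val)) => x y /cH.
  by move=> xy; apply/(subgroup_predP PG); rewrite /P gmulfM gmulfV.
move=> x y /(subgroup_predP PG) Px /(subgroup_predP PG) Py; apply: val_inj.
by rewrite !gmulfM; apply: Hab.
Qed.

(** Generation by p and q as the induction principle on words. *)
Definition generated_by (G : groupType) (p q : G) : Prop :=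
  forall P : G -> Prop,
    P 1 -> (forall x, P x -> P (x * p)) -> (forall x, P x -> P (x * p^-1)) ->
    (forall x, P x -> P (x * q)) -> (forall x, P x -> P (x * q^-1)) ->
  forall x, P x.

Lemma generated_byC (G : groupType) (p q : G) :
  generated_by p q -> generated_by q p.
Proof. by move=> pq P *; apply: pq. Qed.

Lemma commuting_gen_virtually_abelian (G : groupType) (p q : G) :
  generated_by p q -> commute p q -> virtually_abelian G.
Proof.
move=> pqG pq.
have centre (z : G) : commute z p -> commute z q -> forall x, commute z x.
  move=> zp zq; apply: pqG => [|x zx|x zx|x zx|x zx]; first exact: commute1.
  - exact: commuteM.
  - by apply: commuteM => //; apply: commuteV.
  - exact: commuteM.
  - by apply: commuteM => //; apply: commuteV.
apply: (@virtually_abelianI G (fun=> True) [:: 1]) => // [x y _ _|g]; last first.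
  by exists 1; rewrite ?inE.
by apply: (centre x); apply/commute_sym; apply: (centre _) => //; apply/commute_sym.
Qed.

Lemma normal_cycle_virtually_abelian (G : groupType) (t y : G) (N : nat) :
    generated_by t y -> (0 < N)%N -> t ^+ N = 1 ->
    (forall i : nat, exists e, y ^ (t ^+ i) = zexpg y e) ->
  virtually_abelian G.
Proof.
move=> tyG N0 tN norm.
have tV i : t ^- i = t ^+ (N.-1 * i).
  rewrite expgnA -expVgn; congr (_ ^+ _); apply: mulg1_eq.
  by rewrite -expgS prednK.
pose S g := exists j (i : nat), g = zexpg y j * t ^+ i.
have Sy g k : S g -> S (g * zexpg y k).
  move=> [j [i ->]]; have [e ye] := norm (N.-1 * i)%N.
  exists (j + e * k)%R, i; rewrite zexpgD zexpgM -ye -tV zexpgJ.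
  by rewrite /conjg invgK !mulgA mulgVK.
have SG : forall g, S g.
  apply: tyG => [|g [j [i ->]]|g [j [i ->]]|g|g].
  - by exists 0%R, 0%N; rewrite mulg1.
  - by exists j, i.+1; rewrite expgSr mulgA.
  - by exists j, (i + N.-1)%N; rewrite expgnDr -[N.-1]muln1 -tV mulgA.
  - exact: (Sy _ 1%R).
  - exact: (Sy _ (- 1)%R).
apply: (@virtually_abelianI G (fun g => exists j, g = zexpg y j)
  [seq t ^+ i | i <- iota 0 N]).
- split; first by exists 0%R.
  by move=> _ _ [j ->] [k ->]; exists (j - k)%R; rewrite zexpgD zexpgN.
- by move=> _ _ [j ->] [k ->]; apply: zexpgC.
move=> g; have [j [i ->]] := SG g; exists (t ^+ (i %% N)).
  by apply/map_f; rewrite mem_iota /= ltn_mod.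
by exists j; rewrite expg_modn // mulgK.
Qed.

(** * Groups with a dihedral quotient *)

(** With u = q ^ 2, the subgroup <u> is normal and the quotient by it is
    generated by two involutions, hence dihedral; its rotations are the powers
    of the class of p q, whose square is the class of x.  As p ^ 2 = 1,
    conjugation by p squares to the identity on <u>, so u commutes with x, and
    <u, x> is abelian with coset representatives 1, p, q and p q. *)
Section Dihedral.
Variables (G : groupType) (p q : G) (e : int).
Hypotheses (pqG : generated_by p q) (pp : p * p = 1).
Hypothesis qp : (q * q) ^ p = zexpg (q * q) e.
Let u := q * q.
Let x := p * q * p * q.

Let pV : p^-1 = p. Proof. by apply: mulg1_eq. Qed.
Let qV : q^-1 = zexpg u (-1) * q.
Proof. by rewrite /= expg1 /u invgM mulgVK. Qed.

Let uq m : zexpg u m * q = q * zexpg u m.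
Proof.
have : commute (zexpg u m) (zexpg q 1); last by [].
by apply: commute_zexp; rewrite /u /commute mulgA.
Qed.

Let pu m : p * zexpg u m = zexpg u (e * m)%R * p.
Proof.
rewrite zexpgM -[zexpg u e]qp zexpgJ /conjg pV -!mulgA.
by rewrite pp mulg1.
Qed.

Let pue m : p * zexpg u (e * m)%R = zexpg u m * p.
Proof.
apply: (mulgI p); rewrite !mulgA pp mul1g pu -mulgA pp mulg1 //.
Qed.

Let ux : commute u x.
Proof.
rewrite /commute /x -[u]/(zexpg u 1).
rewrite -!mulgA -uq (mulgA p (zexpg _ _)) pu !mulgA -(mulgA p q) -uq.
by rewrite (mulgA p) pue.
Qed.

Let P g := exists i j, g = zexpg u i * zexpg x j.

Let PG : subgroup P.
Proof.
split; first by exists 0%R, 0%R; rewrite mulg1.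
move=> _ _ [i [j ->]] [k [l ->]]; exists (i - k)%R, (j - l)%R.
rewrite invgM -!zexpgN !zexpgD -!mulgA; congr (_ * _).
rewrite (mulgA (zexpg x j)) -zexpgD.
by apply: commute_zexp; apply: commute_sym.
Qed.

Let PM h k : P h -> P k -> P (h * k).
Proof. exact: (subgroupM PG). Qed.

Let Pu m : P (zexpg u m). Proof. by exists m, 0%R; rewrite mulg1. Qed.
Let Px m : P (zexpg x m). Proof. by exists 0%R, m; rewrite mul1g. Qed.

Lemma dihedral_virtually_abelian : virtually_abelian G.
Proof.
apply: (@virtually_abelianI G P [:: 1; p; q; p * q]) => //.
  move=> _ _ [i [j ->]] [k [l ->]].
  by apply: commuteM; apply: commute_sym; apply: commuteM; apply: commute_zexp;
    rewrite // ; apply: commute_sym.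
pose S g := exists2 h, P h & [\/ g = h, g = h * p, g = h * q | g = h * (p * q)].
suff SG g : S g.
  move=> g; have [h Ph [] ->] := SG g.
  - by exists 1; rewrite ?inE ?eqxx // invg1 mulg1.
  - by exists p; rewrite ?inE ?eqxx ?orbT // mulgK.
  - by exists q; rewrite ?inE ?eqxx ?orbT // mulgK.
  - by exists (p * q); rewrite ?inE ?eqxx ?orbT // mulgK.
have pqpE : p * q * p = zexpg x 1 * zexpg u (- 1) * q.
  by rewrite -[RHS]mulgA -qV /= /x mulgK.
have qpE : q * p = zexpg x (- 1) * zexpg u 1 * (p * q).
  apply: (mulgI (zexpg x 1)).
  rewrite [RHS]mulgA [X in X * (p * q)]mulgA zexpgN mulgV mul1g.
  rewrite (zexpg1 x) (zexpg1 u) /x -!mulgA.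
  have -> : q * (q * p) = u * p by rewrite mulgA.
  have -> : p * (u * p) = zexpg u (e * 1)%R by rewrite mulr1 -qp /conjg pV.
  by rewrite -uq (mulgA p) pue zexpg1 /u -!mulgA.
have Sp g' : S g' -> S (g' * p).
  case=> h Ph [] ->.
  - by exists h; [|constructor 2].
  - by exists h; [|constructor 1; rewrite -mulgA pp mulg1].
  - exists (h * (zexpg x (- 1) * zexpg u 1)); first by apply: (PM Ph); apply: PM.
    by constructor 4; rewrite -!(mulgA h) -qpE.
  - exists (h * (zexpg x 1 * zexpg u (- 1))); first by apply: (PM Ph); apply: PM.
    by constructor 3; rewrite -!(mulgA h) -pqpE.
have Sq g' : S g' -> S (g' * q).
  case=> h Ph [] ->.
  - by exists h; [|constructor 3].
  - by exists h; [|constructor 4; rewrite mulgA].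
  - exists (h * zexpg u 1); first exact: (PM Ph).
    by constructor 1; rewrite -(mulgA h) zexpg1.
  - exists (h * zexpg u (e * 1)%R); first exact: (PM Ph).
    by constructor 2; rewrite -!(mulgA h) -pu zexpg1 /u !mulgA.
have SqV g' : S g' -> S (g' * q^-1).
  case=> h Ph [] ->.
  - exists (h * zexpg u (- 1)); first exact: (PM Ph).
    by constructor 3; rewrite qV mulgA.
  - exists (h * zexpg u (e * - 1)%R); first exact: (PM Ph).
    by constructor 4; rewrite qV -!(mulgA h) (mulgA p) pu -!mulgA.
  - by exists h; [|constructor 1; rewrite mulgK].
  - by exists h; [|constructor 2; rewrite -!mulgA mulgV mulg1].
apply: (pqG (P := S)) => //; last by rewrite pV.
by exists 1; [exact: PG.1 | constructor 1].
Qed.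

End Dihedral.

(** * Conjugations taking a power to a power *)

Lemma coprimez_powB (r s : int) (m : nat) :
  (0 < m)%N -> coprimez r s -> coprimez r (r ^+ m - s ^+ m)%R.
Proof.
case: m => // m _ rs; rewrite exprSr /coprimez gcdzMDl -/(coprimez _ _).
by rewrite coprimezN coprimez_pexpr.
Qed.

Section BaumslagSolitar.
Variables (G : groupType) (y b : G) (r s : int) (N : nat).
Hypotheses (yb : zexpg y s ^ b = zexpg y r) (bN : b ^+ N = 1).

(** Iterating the relation needs the exponent s ^ l: each conjugation trades
    one factor s for a factor r. *)
Lemma conj_iter_pow l :
  zexpg y (s ^+ l)%R ^ (b ^+ l) = zexpg y (r ^+ l)%R.
Proof.
elim: l => [|l IH]; first by rewrite conjg1.
rewrite expgSr conjgM exprSr zexpgM -zexpgJ IH -zexpgM mulrC zexpgM.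
by rewrite -zexpgJ yb -zexpgM -exprS.
Qed.

Lemma conj_torsion : zexpg y (r ^+ N - s ^+ N)%R = 1.
Proof.
by rewrite zexpgD zexpgN -conj_iter_pow bN conjg1 mulgV.
Qed.

(** The order of y divides r ^ N - s ^ N, which is prime to s; so y is a power
    of y ^ s, whose conjugate is a power of y. *)
Lemma conj_coprime : (0 < N)%N -> coprimez r s -> exists e, y ^ b = zexpg y e.
Proof.
move=> N0 rs.
have /coprimezP[[u v] /= uv] : coprimez s (r ^+ N - s ^+ N)%R.
  by rewrite -opprB coprimezN coprimez_powB // coprimez_sym.
exists (r * u)%R; rewrite zexpgM -yb zexpgJ -zexpgM; congr (_ ^ b).
rewrite -[LHS](zexpg1 y) -uv zexpgD (mulrC v) (zexpgM y (_ - _)%R).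
by rewrite conj_torsion zexp1g mulg1 mulrC.
Qed.

End BaumslagSolitar.

Lemma conj_cycle_expg (G : groupType) (y b : G) e l :
  y ^ b = zexpg y e -> exists e', y ^ (b ^+ l) = zexpg y e'.
Proof.
move=> yb; elim: l => [|l [e' IH]]; first by exists 1%R; rewrite conjg1.
by exists (e * e')%R; rewrite expgSr conjgM IH -zexpgJ yb -zexpgM.
Qed.

(** The steps of y on the torus are c_i = (r / s) ^ l when i = i0 + l a modulo
    m d with i0 < d.  This is consistent since (r / s) ^ m = 1 modulo k. *)
Lemma twist_exists (k' m d a : nat) (r s : int) :
    coprimez r k'.+2 -> (k'.+2 %| (r ^+ m - s ^+ m)%R)%Z ->
    (0 < d)%N -> (0 < m)%N -> gcdn (m * d) a = d ->
  exists c : nat -> 'I_k'.+2, (forall i, (i < d)%N -> c i = 1%R) /\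
    forall i, (c i *~ r = c ((i + a) %% (m * d))%N *~ s)%R.
Proof.
move=> rk ksr d0 m0 gd; pose R : comNzRingType := 'I_k'.+2.
have k0 : (k'.+2%:~R = 0 :> R)%R.
  by apply: val_inj; rewrite -pmulrn Zp_nat /= modnn.
have [[u v] /= uv] := coprimezP _ _ rk.
(* rho is s / r in Z / k, the inverse of r being u. *)
pose rho : R := (s * u)%:~R%R.
have rrho : (r%:~R * rho = s%:~R)%R.
  rewrite -intrM; have -> : (r * (s * u) = s - s * v * Posz k'.+2)%R.
    rewrite -[X in (X - _)%R]mulr1 -uv; ring.
  by rewrite rmorphB /= rmorphM /= k0 mulr0 subr0.
have rhom : (rho ^+ m = 1)%R.
  have ru : (r%:~R * u%:~R = 1 :> R)%R.
    rewrite -intrM; have -> : (r * u = 1 - v * Posz k'.+2)%R by rewrite -uv; ring.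
    by rewrite rmorphB /= rmorphM /= k0 mulr0 subr0.
  rewrite /rho intrM exprMn.
  have -> : (s%:~R ^+ m = r%:~R ^+ m :> R)%R.
    apply/esym/eqP; rewrite -subr_eq0 -!rmorphXn -rmorphB /=.
    by move/dvdzP: ksr => [q ->]; rewrite rmorphM /= k0 mulr0.
  by rewrite -exprMn ru expr1n.
have [a' aE] : exists a', a = (a' * d)%N.
  by apply/dvdnP; rewrite -gd dvdn_gcdr.
have ma' : gcdn m a' = 1%N.
  by apply/eqP; rewrite -(eqn_pmul2r d0) muln_gcdl -aE gd mul1n.
(* kn is minus the inverse of a' = a / d modulo m, so that moving by a
   multiplies the step by r / s. *)
case: (egcdnP a' m0) => km kn kE _; rewrite ma' in kE.
exists (fun i => rho ^+ ((i %/ d) * kn))%R; split.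
  by move=> i id; rewrite divn_small.
move=> i; rewrite -(mulrzr _ r) -(mulrzr _ s).
have -> : ((i + a) %% (m * d) %/ d = (i %/ d + a') %% m)%N.
  by rewrite -modn_divl aE addnC divnMDl // addnC.
have -> : (rho ^+ (((i %/ d + a') %% m) * kn) = rho ^+ ((i %/ d + a') * kn))%R.
  by rewrite !exprM expr_mod.
rewrite mulnDl exprD -rrho -mulrA; congr (_ * _)%R.
rewrite mulrCA -exprSr mulnC -addn1 -kE mulnC exprM rhom expr1n mulr1 //.
Qed.

Lemma divisor_gt2 (z : int) : `|z|%N != 1%N -> `|z|%N != 2%N ->
  exists k, (k.+3 %| z)%Z.
Proof.
move=> z1 z2; have [->|z0] := eqVneq z 0; first by exists 0%N; rewrite dvdz0.
exists (`|z| - 3)%N; rewrite (_ : (_ - 3).+3 = `|z|%N); last by lia.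
exact: dvdnn.
Qed.

(** * The dichotomy for E *)

Section Dichotomy.
Variables (r n s A : int) (N : nat).
Hypotheses (nE : n = N) (N0 : (0 < N)%N).
Notation E := (E_group r n s A).
Notation t := (E_t r n s A).
Notation y := (E_y r n s A).
Let a := `|(A %% n)%Z|%N.
Let b := t ^- a.
Let d := gcdn N a.

Let d_gt0 : (0 < d)%N. Proof. by rewrite gcdn_gt0 N0. Qed.
Let dN : (d %| N)%N. Proof. exact: dvdn_gcdl. Qed.
Let da : (d %| a)%N. Proof. exact: dvdn_gcdr. Qed.

Let m0 : (0 < N %/ d)%N.
Proof. by rewrite (divn_gt0 _ d_gt0); exact: (dvdn_leq N0 dN). Qed.

Let n_gt0 : (0 < n)%R. Proof. by rewrite nE. Qed.

Let a_lt : (a < N)%N.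
Proof.
by rewrite -ltz_nat /a gez0_abs ?modz_ge0 ?lt0r_neq0 // -nE ltz_pmod.
Qed.

Let tN : t ^+ N = 1.
Proof. by have := E_t_order r n s A; rewrite [X in zexpg _ X]nE. Qed.

Let yb : zexpg y s ^ b = zexpg y r.
Proof.
have := E_rel r n s A; rewrite (zexpg_nat A n_gt0 (E_t_order r n s A)) => rel.
by rewrite /b /conjg invgK mulgA -rel mulgK.
Qed.

Let bX : b ^+ (N %/ d) = 1.
Proof.
rewrite /b expVgn -expgnA (_ : (_ * _)%N = (N * (a %/ d))%N).
  by rewrite expgnA tN expg1n invg1.
by rewrite -{1}(divnK da) -mulnA (mulnC d) divnK // mulnC.
Qed.

(** d is a combination of n and a, so t ^ d is a power of t ^ a. *)
Let td : exists l, t ^+ d = b ^+ l.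
Proof.
case: (egcdnP a N0) => km kn kE _; exists kn.
apply: (mulgI (t ^+ (kn * a))); rewrite -expgnDr -kE.
by rewrite mulnC expgnA tN expg1n mulnC expgnA /b expVgn mulgV.
Qed.

Let large_torus k e (c : nat -> 'I_k.+2) :
    (e %| N)%N -> (1 < e)%N -> (2 < e)%N || (0 < k)%N ->
    (forall i, (i < e)%N -> c i = 1%R) ->
    (e %| a)%N /\ (forall i, (c i *~ r)%R = (c ((i + a) %% N)%N *~ s)%R)
    \/ (k.+2 %| r)%Z /\ (k.+2 %| s)%Z ->
  large E.
Proof.
move=> eN e1 ek c1 rc; case: N nE eN rc => [nE0|n' nE' eN rc].
  by move: n_gt0; rewrite nE0.
apply: (E_large_torus (d := e) nE' eN e1 ek c1).
by case: rc => [[ea rc]|rc]; [left; split=> // i _; apply: rc | right].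
Qed.

(** E maps onto the free product Z_N * Z_k. *)
Let large_common k : (1 < N)%N -> (1 < k)%N -> (2 < N)%N || (2 < k)%N ->
  (k %| r)%Z -> (k %| s)%Z -> large E.
Proof.
case: k => [|[|k]] // N1 _ Nk kr ks.
by apply: (@large_torus k N (fun=> 1%R)) => //; right.
Qed.

(** E maps onto the group with t ^ d commuting with y and y ^ k = 1. *)
Let large_quotient k : (1 < d)%N -> (1 < k)%N -> (2 < d)%N || (2 < k)%N ->
  (k %| (r - s)%R)%Z -> large E.
Proof.
case: k => [|[|k]] // d1 _ dk /dvdzP[q rs].
apply: (@large_torus k d (fun=> 1%R)) => //; left; split=> // _.
apply/eqP; rewrite -subr_eq0 -mulrzBr rs mulrC mulrzA.
rewrite -[(1 *~ _)%R]pmulrn Zp_nat.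
by rewrite (_ : inZp _ = 0%R) ?mul0rz //; apply: val_inj; rewrite /= modnn.
Qed.

(** All d factors of the free product M map onto Z_k. *)
Let large_coprime k : coprimez r s -> (1 < d)%N -> (1 < k)%N ->
    (2 < d)%N || (2 < k)%N -> (k %| (r ^+ (N %/ d) - s ^+ (N %/ d))%R)%Z ->
  large E.
Proof.
case: k => [|[|k]] // rs d1 _ dk krs.
have rk : coprimez r k.+2.
  by apply: coprimez_dvdr (coprimez_powB m0 rs); move: krs; rewrite dvdzE.
have Nd : (N %/ d * d)%N = N by rewrite divnK.
have [c [c1 cr]] := @twist_exists k (N %/ d) d a r s rk krs d_gt0 m0
  (congr1 (gcdn^~ a) Nd).
apply: (@large_torus k d c) => //; left; split=> // i.
by rewrite cr Nd.
Qed.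

Let tyG : generated_by t y. Proof. by move=> P *; apply: E_ind. Qed.

(** Here M is the free product of d cyclic groups of order |K|. *)
Let coprime_case : coprimez r s -> large E \/ virtually_abelian E.
Proof.
move=> rs; have [l tdE] := td.
have [d1|d1] := leqP d 1.
  right; apply: (normal_cycle_virtually_abelian tyG N0 tN) => i.
  have {d1} d1 : d = 1%N by apply/eqP; rewrite eqn_leq d1.
  have bN : b ^+ N = 1 by rewrite -(divnK dN) expgnA bX expg1n.
  have [e ye] := conj_coprime yb bN N0 rs.
  rewrite -[t]expg1 -d1 tdE -expgnA.
  exact: conj_cycle_expg ye.
have rK := coprimez_powB m0 rs.
have sK : coprimez s (r ^+ (N %/ d) - s ^+ (N %/ d))%R.
  by rewrite -opprB coprimezN coprimez_powB // coprimez_sym.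
have := conj_torsion yb bX; have large_k k := @large_coprime k rs d1.
move: (_ - _)%R rK sK large_k => K rK sK large_k yK.
have [K1|K1] := eqVneq `|K|%N 1%N.
  right; apply: (commuting_gen_virtually_abelian tyG).
  have -> : y = 1; last exact: commute1.
  by have := zexpg_absz yK; rewrite K1.
have [K2|K2] := eqVneq `|K|%N 2%N; last first.
  left; have [k kK] := divisor_gt2 K1 K2.
  by apply: (large_k k.+3) => //; rewrite orbT.
have two_K : (2 %| K)%Z by rewrite dvdzE K2.
have [d2|d2] := ltnP 2 d; first by left; apply: (large_k 2%N); rewrite ?d2.
have {d2}dE : d = 2%N by apply/eqP; rewrite eqn_leq d2.
have yy : y * y = 1.
  by have := zexpg_absz yK; rewrite K2.
(* r and s are odd because they are coprime to the even number K. *)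
have odd_of (m : int) : coprimez m K -> odd `|m|.
  by move=> mK; rewrite -coprimen2; apply: coprimez_dvdr mK; rewrite K2.
have yby : y ^ b = y by have := yb; rewrite !zexpg_odd // odd_of.
have ty : commute y (t * t).
  rewrite -[t * t]/(t ^+ 2) -dE tdE; apply: commuteX.
  by rewrite /commute -{2}yby -conjgC.
right; apply: (dihedral_virtually_abelian (generated_byC tyG) yy (e := 1%R)).
by apply: (mulgI y); rewrite -conjgC zexpg1.
Qed.

Theorem E_dichotomy : large E \/ virtually_abelian E.
Proof.
have [N1|N1] := leqP N 1.
  right; apply: (commuting_gen_virtually_abelian tyG).
  have -> : t = 1; last exact/commute_sym/commute1.
  by rewrite -[t]expg1 -tN; congr (_ ^+ _); lia.
have [rs|rs] := boolP (coprimez r s); first exact: coprime_case.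
pose g := gcdn `|r| `|s|.
have g1 : g != 1%N := rs.
have gr : (g %| r)%Z by rewrite dvdzE dvdn_gcdl.
have gs : (g %| s)%Z by rewrite dvdzE dvdn_gcdr.
(* If r = s = 0, any k may replace g. *)
have [g0|g0] := eqVneq g 0%N.
  left; apply: (@large_common 3) => //; rewrite ?orbT //.
    by apply: dvdz_trans gr; rewrite g0.
  by apply: dvdz_trans gs; rewrite g0.
have [Ng|] := boolP ((2 < N)%N || (2 < g)%N).
  by left; apply: (@large_common g) => //; lia.
rewrite negb_or -!leqNgt => /andP[N2 g2].
have {N1 N2}NE : N = 2%N by lia.
have {g0 g1 g2}gE : g = 2%N by lia.
have tt : t * t = 1 by have := tN; rewrite NE.
have : (a < 2)%N by rewrite -NE.
case aE : a yb => [|[|//]]; rewrite /b aE => yb' _.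
  (* t ^ A = 1, and the relation reads y ^ r = y ^ s. *)
  have yrs : zexpg y (r - s)%R = 1.
    by rewrite zexpgD zexpgN -yb' expg0 invg1 conjg1 mulgV.
  have rs2 : (g %| (r - s)%R)%Z by exact: rpredB.
  rewrite gE in rs2.
  have dE : d = 2%N by rewrite /d NE aE.
  have [K2|K2] := eqVneq `|(r - s)%R|%N 2%N.
    have yy : y * y = 1.
      by have := zexpg_absz yrs; rewrite K2.
    by right; apply: (dihedral_virtually_abelian tyG tt (e := 0%R)); rewrite yy conj1g.
  have K1 : `|(r - s)%R|%N != 1%N.
    by apply: contraTneq rs2 => K1; rewrite dvdzE K1.
  have [k kK] := divisor_gt2 K1 K2.
  by left; apply: (@large_quotient k.+3); rewrite ?dE ?orbT.
(* t ^ A = t, and the coprime case applies to y ^ 2 in place of y. *)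
have [r' rE] := dvdzP gr; have [s' sE] := dvdzP gs.
have rs' : coprimez r' s'.
  have : gcdz r s = g by [].
  rewrite rE sE -mulz_gcdl absz_nat gE => /eqP.
  by rewrite -[X in _ == X]mul1r (inj_eq (mulIf _)).
have tV : t ^- 1 = t by rewrite expg1; apply: mulg1_eq.
have [e ye] : exists e, zexpg y (Posz g) ^ t = zexpg (zexpg y (Posz g)) e.
  apply: (conj_coprime (N := 2) _ tt _ rs') => //.
  by rewrite -!zexpgM -{1}tV !(mulrC (Posz g)) -rE -sE.
by rewrite gE in ye; right; apply: (dihedral_virtually_abelian tyG tt ye).
Qed.

End Dichotomy.

(** * The kernel of the retraction *)

Lemma kernel_exponent (r n s A f : int) (hf : ((f * (r - s))%R = 0 %[mod n])%Z)
    (N : nat) (x : E_group r n s A) : n = N -> x ^+ N \in kerg (nu A hf).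
Proof.
move=> nE; rewrite inE gmulfXn; move: (nu A hf x) => c; apply/eqP.
have /cyclegP[k ck] := valP c.
apply: val_inj; rewrite gmulfXn val1 [X in X ^+ _]ck.
rewrite -[LHS]/(zexpg _ (Posz N)) -zexpgM mulrC -nE zexpgM E_t_order.
exact: zexp1g.
Qed.

Theorem corollary22 (r n s f A : int) (n_gt0 : (0 < n)%R) (r_ge0 : (0 <= r)%R)
    (hf : ((f * (r - s))%R = 0 %[mod n])%Z) :
  let E := E_group r n s A in
  let G : groupType := subg_of (kerg (nu A hf)) in
  (large E \/ virtually_abelian E) /\ (large G \/ virtually_abelian G).
Proof.
move=> E G; have [N nE] : exists N, n = Posz N by exists `|n|%N; rewrite gtz0_abs.
have N0 : (0 < N)%N by rewrite -ltz_nat -nE.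
have [lE|aE] := E_dichotomy r s A nE N0; split; [by left| |by right|].
  left; apply: (large_powers N0) lE => x; exact: kernel_exponent.
by right; apply: virtually_abelian_subgroup.
Qed.
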